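(* Let $T$ be the free model monad of an algebraic theory that has a binary operation $\diamond$. Then the natural transformation $\zeta:TD\to DT$ induced by parallel lifting (i.e. such that for every $T$-model $X$ the $T$-algebra structure on $DX$ induced by $\zeta$ interprets $\diamond$ as the parallel lifting $\diamond^{\mathsf{par}}$) is not a distributive law: it fails the multiplication axiom $\zeta\circ T\mu^D=\mu^D T\circ D\zeta\circ \zeta D$.
   Context: $D$ is the coinductive delay monad: $DX$ is the final coalgebra $DX\simeq X+DX$ with $\mathsf{now}:X\to DX$, $\mathsf{step}:DX\to DX$, unit $\mathsf{now}$ and multiplication $\mu^D$ given by $\mu^D(\mathsf{now}\,x)=x$, $\mu^D(\mathsf{step}\,x)=\mathsf{step}(\mu^D x)$. (In the paper $DX=\forall\kappa.D^\kappa X$ in Clocked Cubical Type Theory, with $D^\kappa X\simeq X+\triangleright^\kappa D^\kappa X$.) For a $T$-model $X$ and an $n$-ary operation $\diamond$, the parallel lifting $\diamond^{\mathsf{par}}:(DX)^n\to DX$ is defined corecursively: $\diamond^{\mathsf{par}}(\mathsf{now}\,x_1,\dots,\mathsf{now}\,x_n)=\mathsf{now}(\diamond_X(x_1,\dots,x_n))$, and if some argument is of the form $\mathsf{step}(\cdot)$ then $\diamond^{\mathsf{par}}(x_1,\dots,x_n)=\mathsf{step}(\diamond^{\mathsf{par}}(x_1',\dots,x_n'))$, where $x_i'=x_i$ if $x_i=\mathsf{now}(\cdot)$ and $x_i'=z$ if $x_i=\mathsf{step}(z)$. A distributive law of $T$ over $D$ is a natural transformation $\zeta:TD\to DT$ satisfying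 $\zeta\circ\eta^T D=D\eta^T$, $\zeta\circ T\eta^D=\eta^D T$, $\zeta\circ\mu^T D=D\mu^T\circ\zeta T\circ T\zeta$, and $\zeta\circ T\mu^D=\mu^D T\circ D\zeta\circ\zeta D$. *)

(* Defs.v *)
From HB Require Import structures.
From mathcomp Require Import all_boot.
From mathcomp Require Import boolp.

Set Implicit Arguments.
Unset Strict Implicit.
Unset Printing Implicit Defensive.

Record monad := Monad {
  obj :> Type -> Type;
  fmap : forall X Y : Type, (X -> Y) -> obj X -> obj Y;
  unit_ : forall X : Type, X -> obj X;
  mult : forall X : Type, obj (obj X) -> obj X;
  fmap_id : forall (X : Type) (u : obj X), fmap id u = u;
  fmap_comp : forall (X Y Z : Type) (f : X -> Y) (g : Y -> Z) (u : obj X),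
    fmap (g \o f) u = fmap g (fmap f u);
  unit_nat : forall (X Y : Type) (f : X -> Y) (x : X),
    fmap f (unit_ x) = unit_ (f x);
  mult_nat : forall (X Y : Type) (f : X -> Y) (u : obj (obj X)),
    fmap f (mult u) = mult (fmap (fmap f) u);
  mult_unitl : forall (X : Type) (u : obj X), mult (unit_ u) = u;
  mult_unitr : forall (X : Type) (u : obj X), mult (fmap (@unit_ X) u) = u;
  mult_assoc : forall (X : Type) (u : obj (obj (obj X))),
    mult (mult u) = mult (fmap (@mult X) u)
}.

Arguments fmap M {X Y} f u : rename.
Arguments unit_ M {X} x : rename.
Arguments mult M {X} u : rename.

Definition is_algebra (T : monad) (A : Type) (a : T A -> A) : Prop :=
  (forall x : A, a (unit_ T x) = x) /\
  (forall u : T (T A), a (mult T u) = a (fmap T a u)).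

Section DistributiveLaw.
Variables (T D : monad) (zeta : forall X : Type, T (D X) -> D (T X)).

Definition is_natural : Prop :=
  forall (X Y : Type) (f : X -> Y) (u : T (D X)),
    zeta (fmap T (fmap D f) u) = fmap D (fmap T f) (zeta u).

Definition unit_law_T : Prop :=
  forall (X : Type) (d : D X), zeta (unit_ T d) = fmap D (unit_ T) d.

Definition unit_law_D : Prop :=
  forall (X : Type) (u : T X), zeta (fmap T (unit_ D) u) = unit_ D u.

Definition mult_law_T : Prop :=
  forall (X : Type) (u : T (T (D X))),
    zeta (mult T u) = fmap D (mult T) (zeta (fmap T (@zeta X) u)).

Definition mult_law_D : Prop :=
  forall (X : Type) (u : T (D (D X))),
    zeta (fmap T (mult D) u) = mult D (fmap D (@zeta X) (zeta u)).

Record is_distributive_law : Prop := IsDistributiveLaw {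
  dl_natural : is_natural;
  dl_unit_T : unit_law_T;
  dl_unit_D : unit_law_D;
  dl_mult_T : mult_law_T;
  dl_mult_D : mult_law_D
}.

End DistributiveLaw.

Arguments is_natural : clear implicits.
Arguments mult_law_D : clear implicits.
Arguments is_distributive_law : clear implicits.

(* Rocq's own coinductive types are final coalgebras only up to bisimilarity.
   This sequence representation (run d n is the value of d if d terminates
   within n steps) is a final coalgebra for Leibniz equality: see coiterP and
   coiter_unique. *)
Record delay (X : Type) := Delay {
  run : nat -> option X;
  run_mono : forall n x, run n = Some x -> run n.+1 = Some x
}.

Lemma delay_eq (X : Type) (d e : delay X) : run d =1 run e -> d = e.
Proof.
case: d e => [r p] [s q] /= /funext rs; case: s / rs q => q.
by rewrite (Prop_irrelevance p q).
Qed.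

Definition now (X : Type) (x : X) : delay X :=
  @Delay X (fun=> Some x) (fun _ _ e => e).

Definition step_run (X : Type) (r : nat -> option X) (n : nat) : option X :=
  if n is m.+1 then r m else None.

Lemma step_mono (X : Type) (d : delay X) n x :
  step_run (run d) n = Some x -> step_run (run d) n.+1 = Some x.
Proof. by case: n => //= n; apply: run_mono. Qed.

Definition step (X : Type) (d : delay X) : delay X := Delay (@step_mono X d).

Lemma tail_mono (X : Type) (d : delay X) n x :
  run d n.+1 = Some x -> run d n.+2 = Some x.
Proof. exact: run_mono. Qed.

Definition tail (X : Type) (d : delay X) : delay X := Delay (@tail_mono X d).

Definition out (X : Type) (d : delay X) : X + delay X :=
  if run d 0 is Some x then inl x else inr (tail d).

Lemma out_now (X : Type) (x : X) : out (now x) = inl x.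
Proof. by []. Qed.

Lemma out_step (X : Type) (d : delay X) : out (step d) = inr d.
Proof. by congr inr; apply: delay_eq. Qed.

Definition inn (X : Type) (s : X + delay X) : delay X :=
  match s with inl x => now x | inr d => step d end.

Lemma innK (X : Type) : cancel (@inn X) (@out X).
Proof. by case=> [x|d]; [exact: out_now | exact: out_step]. Qed.

Lemma outK (X : Type) : cancel (@out X) (@inn X).
Proof.
move=> d; apply: delay_eq; rewrite /out.
case d0: (run d 0) => [x|] n /=; last by case: n.
by apply/esym; elim: n => // n IHn; apply: run_mono.
Qed.

Lemma delayP (X : Type) (d : delay X) :
  {x | d = now x} + {d' | d = step d'}.
Proof.
by rewrite -(outK d); case: (out d) => [x|d']; [left; exists x|right; exists d'].
Qed.

Lemma now_inj (X : Type) : injective (@now X).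
Proof. by move=> x y /(congr1 (@out X)) []. Qed.

Lemma step_inj (X : Type) : injective (@step X).
Proof. by move=> d e /(congr1 (@out X)); rewrite !out_step => -[]. Qed.

Lemma now_neq_step (X : Type) (x : X) (d : delay X) : now x <> step d.
Proof. by move/(congr1 (@out X)); rewrite out_step. Qed.

Section Coiteration.
Variables (S X : Type) (c : S -> X + S).

Fixpoint coiter_run (s : S) (n : nat) : option X :=
  match c s with
  | inl x => Some x
  | inr s' => if n is m.+1 then coiter_run s' m else None
  end.

Lemma coiter_mono s n x :
  coiter_run s n = Some x -> coiter_run s n.+1 = Some x.
Proof.
elim: n s => [|n IHn] s; first by rewrite /=; case: (c s).
rewrite [coiter_run s n.+1]/= [coiter_run s n.+2]/=.
by case: (c s) => // s' /IHn.
Qed.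

Definition coiter (s : S) : delay X := Delay (@coiter_mono s).

Definition coalg_mor (h : S -> delay X) : Prop :=
  forall s, out (h s) = match c s with inl x => inl x | inr s' => inr (h s') end.

Lemma coiterP : coalg_mor coiter.
Proof.
move=> s; rewrite /out /=; case cs: (c s) => [x|s'] //.
by congr inr; apply: delay_eq => n; rewrite /= cs.
Qed.

Lemma coiter_unique h : coalg_mor h -> h =1 coiter.
Proof.
move=> hP s; apply: delay_eq => n; elim: n s => [|n IHn] s.
  by rewrite -[h s]outK hP /=; case: (c s).
by rewrite -[h s]outK hP /=; case: (c s) => //= s'; apply: IHn.
Qed.

Lemma coiterE s :
  coiter s = match c s with inl x => now x | inr s' => step (coiter s') end.
Proof. by rewrite -[LHS]outK coiterP; case: (c s). Qed.

End Coiteration.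

Lemma delay_bisim (X : Type) (R : delay X -> delay X -> Prop) :
  (forall d e, R d e ->
     (exists x, d = now x /\ e = now x) \/
     (exists d' e', [/\ d = step d', e = step e' & R d' e'])) ->
  forall d e, R d e -> d = e.
Proof.
move=> RP d e Rde; apply: delay_eq => n.
elim: n d e Rde => [|n IHn] d e /RP [[x [-> ->]]|[d' [e' [-> -> Rde]]]] //=.
exact: IHn.
Qed.

Definition delay_map (X Y : Type) (f : X -> Y) : delay X -> delay Y :=
  coiter (fun d => match out d with inl x => inl (f x) | inr d' => inr d' end).

Lemma delay_map_now (X Y : Type) (f : X -> Y) x :
  delay_map f (now x) = now (f x).
Proof. by rewrite /delay_map coiterE out_now. Qed.

Lemma delay_map_step (X Y : Type) (f : X -> Y) d :
  delay_map f (step d) = step (delay_map f d).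
Proof. by rewrite {1}/delay_map coiterE out_step. Qed.

Definition delay_mult (X : Type) : delay (delay X) -> delay X :=
  coiter (fun dd => match out dd with
                    | inl d => match out d with
                               | inl x => inl x
                               | inr d' => inr (now d')
                               end
                    | inr dd' => inr dd'
                    end).

Lemma delay_mult_now (X : Type) (d : delay X) : delay_mult (now d) = d.
Proof.
pose R (a b : delay X) := a = delay_mult (now b).
apply: (@delay_bisim _ R) => // _ e ->.
case: (delayP e) => [[x ->]|[e' ->]].
  by left; exists x; split; rewrite // /delay_mult coiterE !out_now.
right; exists (delay_mult (now e')), e'; split=> //.
by rewrite {1}/delay_mult coiterE out_now out_step.
Qed.

Lemma delay_mult_step (X : Type) (dd : delay (delay X)) :
  delay_mult (step dd) = step (delay_mult dd).
Proof. by rewrite {1}/delay_mult coiterE out_step. Qed.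

Definition delayE :=
  (delay_map_now, delay_map_step, delay_mult_now, delay_mult_step).

Lemma delay_map_id (X : Type) (d : delay X) : delay_map id d = d.
Proof.
apply: (@delay_bisim _ (fun a b => a = delay_map id b)) => // _ e ->.
case: (delayP e) => [[x ->]|[e' ->]]; rewrite delayE.
  by left; exists x.
by right; exists (delay_map id e'), e'.
Qed.

Lemma delay_map_comp (X Y Z : Type) (f : X -> Y) (g : Y -> Z) (d : delay X) :
  delay_map (g \o f) d = delay_map g (delay_map f d).
Proof.
pose R a b :=
  exists d, a = delay_map (g \o f) d /\ b = delay_map g (delay_map f d).
apply: (@delay_bisim _ R); last by exists d.
move=> _ _ [e [-> ->]]; case: (delayP e) => [[x ->]|[e' ->]]; rewrite !delayE.
  by left; exists (g (f x)).
right; exists (delay_map (g \o f) e'), (delay_map g (delay_map f e')).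
by split=> //; exists e'.
Qed.

Lemma delay_mult_nat (X Y : Type) (f : X -> Y) (u : delay (delay X)) :
  delay_map f (delay_mult u) = delay_mult (delay_map (delay_map f) u).
Proof.
pose R a b := a = b \/ exists u,
  a = delay_map f (delay_mult u) /\ b = delay_mult (delay_map (delay_map f) u).
apply: (@delay_bisim _ R); last by right; exists u.
move=> a _ [<-|[v [-> ->]]].
  case: (delayP a) => [[x ->]|[a' ->]]; first by left; exists x.
  by right; exists a', a'; split=> //; left.
case: (delayP v) => [[d ->]|[v' ->]]; rewrite !delayE.
  case: (delayP (delay_map f d)) => [[x ->]|[a' ->]]; first by left; exists x.
  by right; exists a', a'; split=> //; left.
right; do 2!eexists; split; first by reflexivity.
  by reflexivity.
by right; exists v'.
Qed.

Lemma delay_mult_unitr (X : Type) (d : delay X) :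
  delay_mult (delay_map (@now X) d) = d.
Proof.
pose R a b := a = delay_mult (delay_map (@now X) b).
apply: (@delay_bisim _ R) => // _ e ->.
case: (delayP e) => [[x ->]|[e' ->]]; rewrite !delayE; first by left; exists x.
by right; do 2!eexists; split.
Qed.

Lemma delay_mult_assoc (X : Type) (u : delay (delay (delay X))) :
  delay_mult (delay_mult u) = delay_mult (delay_map (@delay_mult X) u).
Proof.
pose R a b := a = b \/ exists u,
  a = delay_mult (delay_mult u) /\ b = delay_mult (delay_map (@delay_mult X) u).
apply: (@delay_bisim _ R); last by right; exists u.
move=> a _ [<-|[v [-> ->]]].
  case: (delayP a) => [[x ->]|[a' ->]]; first by left; exists x.
  by right; exists a', a'; split=> //; left.
case: (delayP v) => [[d ->]|[v' ->]]; rewrite !delayE.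
  case: (delayP (delay_mult d)) => [[x ->]|[a' ->]]; first by left; exists x.
  by right; exists a', a'; split=> //; left.
right; do 2!eexists; split; first by reflexivity.
  by reflexivity.
by right; exists v'.
Qed.

Definition delay_monad : monad :=
  @Monad delay delay_map now delay_mult
    delay_map_id delay_map_comp delay_map_now delay_mult_nat
    delay_mult_now delay_mult_unitr delay_mult_assoc.

Definition skip (X : Type) (d : delay X) : delay X :=
  match out d with inl _ => d | inr d' => d' end.

(* The two corecursive clauses hold as equations: par_now and par_step. *)
Definition par (n : nat) (X : Type) (op : ('I_n -> X) -> X) :
  ('I_n -> delay X) -> delay X :=
  coiter (fun ds =>
    match pselect (exists xs : 'I_n -> X, ds = (@now X) \o xs) with
    | left ex => inl (op (projT1 (cid ex)))
    | right _ => inr ((@skip X) \o ds)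
    end).

Lemma skip_now (X : Type) (x : X) : skip (now x) = now x.
Proof. by []. Qed.

Lemma skip_step (X : Type) (d : delay X) : skip (step d) = d.
Proof. by rewrite /skip out_step. Qed.

Lemma par_now (n : nat) (X : Type) (op : ('I_n -> X) -> X) (xs : 'I_n -> X) :
  par op (fun i => now (xs i)) = now (op xs).
Proof.
rewrite /par coiterE; case: pselect => [ex|[]]; last by exists xs.
case: cid => ys /= /(congr1 (fun f => f _)) xys; congr (now (op _)).
by apply: funext => i; apply: now_inj; rewrite xys.
Qed.

Lemma par_step (n : nat) (X : Type) (op : ('I_n -> X) -> X)
    (ds : 'I_n -> delay X) :
  (exists i z, ds i = step z) -> par op ds = step (par op (fun i => skip (ds i))).
Proof.
move=> [i [z dsi]]; rewrite {1}/par coiterE; case: pselect => // ex; exfalso; case: ex => xs dsE.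
by rewrite dsE in dsi; case: (now_neq_step dsi).
Qed.

Record signature := Signature {
  op_symb :> Type;
  arity : op_symb -> nat
}.

Inductive term (S : signature) (X : Type) : Type :=
| Var (x : X)
| App (o : S) (args : 'I_(arity o) -> term S X).

Arguments Var {S X} x.
Arguments App {S X} o args.

Record theory := Theory {
  sig :> signature;
  axioms : term sig nat -> term sig nat -> Prop
}.

Fixpoint eval (S : signature) (X A : Type)
    (int : forall o : S, ('I_(arity o) -> A) -> A) (v : X -> A) (t : term S X)
    : A :=
  match t with
  | Var x => v x
  | App o args => int o (fun i => eval int v (args i))
  end.

Definition subst (S : signature) (X Y : Type) (v : X -> term S Y) :
  term S X -> term S Y := eval (@App S Y) v.

Record model (Th : theory) := Model {
  carrier :> Type;
  interp : forall o : Th, ('I_(arity o) -> carrier) -> carrier;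
  model_sat : forall l r : term Th nat, axioms l r ->
    forall v : nat -> carrier, eval interp v l = eval interp v r
}.

Arguments interp {Th} M o args : rename.

Definition is_hom (Th : theory) (M N : model Th) (h : M -> N) : Prop :=
  forall (o : Th) (args : 'I_(arity o) -> M),
    h (interp M o args) = interp N o (fun i => h (args i)).

Inductive provable (Th : theory) (X : Type) : term Th X -> term Th X -> Prop :=
| provable_refl t : provable t t
| provable_sym s t : provable s t -> provable t s
| provable_trans s t u : provable s t -> provable t u -> provable s u
| provable_cong (o : Th) (ss ts : 'I_(arity o) -> term Th X) :
    (forall i, provable (ss i) (ts i)) -> provable (App o ss) (App o ts)
| provable_axiom (l r : term Th nat) (v : nat -> term Th X) :
    axioms l r -> provable (subst v l) (subst v r).

HB.instance Definition _ (S : signature) (X : Type) := gen_eqMixin (term S X).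
HB.instance Definition _ (S : signature) (X : Type) :=
  gen_choiceMixin (term S X).

Section FreeModel.
Variables (Th : theory) (X : Type).

Definition provableb (s t : term Th X) : bool := `[< provable s t >].

Lemma provableb_refl : reflexive provableb.
Proof. by move=> t; apply/asboolP; apply: provable_refl. Qed.

Lemma provableb_sym : symmetric provableb.
Proof. by move=> s t; apply/asboolP/asboolP; apply: provable_sym. Qed.

Lemma provableb_trans : transitive provableb.
Proof.
move=> t s u /asboolP st /asboolP tu; apply/asboolP.
exact: provable_trans st tu.
Qed.

Canonical provable_equiv :=
  EquivRel provableb provableb_refl provableb_sym provableb_trans.

Definition free : Type := {eq_quot provable_equiv}%qT.

Definition cls (t : term Th X) : free := (\pi_{eq_quot provable_equiv} t)%qT.
Definition rep (q : free) : term Th X :=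
  repr (q : {eq_quot provable_equiv}%qT).

Lemma repK (q : free) : cls (rep q) = q.
Proof. exact: reprK. Qed.

Lemma clsP (s t : term Th X) : cls s = cls t <-> provable s t.
Proof.
split=> [st|st]; last by apply/eqquotP/asboolP.
by apply/asboolP; move: st => /eqquotP.
Qed.

Lemma rep_cls (t : term Th X) : provable (rep (cls t)) t.
Proof. by apply/clsP; rewrite repK. Qed.

Definition free_var (x : X) : free := cls (Var x).

Definition free_interp (o : Th) (args : 'I_(arity o) -> free) : free :=
  cls (App o (fun i => rep (args i))).

Lemma cls_App (o : Th) (args : 'I_(arity o) -> term Th X) :
  cls (App o args) = free_interp (fun i => cls (args i)).
Proof.
by apply/clsP; apply: provable_cong => i; apply/provable_sym/rep_cls.
Qed.

Lemma eval_free (Y : Type) (v : Y -> free) (t : term Th Y) :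
  eval free_interp v t = cls (subst (fun y => rep (v y)) t).
Proof.
elim: t => [y|o args IH] /=; first by rewrite repK.
by rewrite cls_App; congr free_interp; apply: funext.
Qed.

Lemma free_sat (l r : term Th nat) : axioms l r ->
  forall v : nat -> free, eval free_interp v l = eval free_interp v r.
Proof. by move=> lr v; rewrite !eval_free; apply/clsP/provable_axiom. Qed.

Definition free_model : model Th := Model free_sat.

Lemma eval_subst (M : model Th) (Y : Type) (v : X -> M) (w : Y -> term Th X)
    (t : term Th Y) :
  eval (interp M) v (subst w t) = eval (interp M) (fun y => eval (interp M) v (w y)) t.
Proof.
by elim: t => //= o args IH; congr interp; apply: funext.
Qed.

Lemma eval_sound (M : model Th) (v : X -> M) (s t : term Th X) :
  provable s t -> eval (interp M) v s = eval (interp M) v t.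
Proof.
elim=> {s t} //=.
- by move=> s t u _ -> _ ->.
- by move=> o ss ts _ IH; congr interp; apply: funext.
- by move=> l r w lr; rewrite !eval_subst; apply: model_sat.
Qed.

Definition free_ext (M : model Th) (v : X -> M) (q : free) : M :=
  eval (interp M) v (rep q).

Lemma free_ext_cls (M : model Th) (v : X -> M) t :
  free_ext v (cls t) = eval (interp M) v t.
Proof. exact/eval_sound/rep_cls. Qed.

Lemma free_ext_hom (M : model Th) (v : X -> M) :
  @is_hom Th free_model M (free_ext v).
Proof. by move=> o args /=; rewrite free_ext_cls. Qed.

Lemma free_ext_var (M : model Th) (v : X -> M) x :
  free_ext v (free_var x) = v x.
Proof. by rewrite /free_var free_ext_cls. Qed.

Lemma free_ext_unique (M : model Th) (v : X -> M) (h : free_model -> M) :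
  is_hom h -> (forall x, h (free_var x) = v x) -> h =1 free_ext v.
Proof.
move=> hH hv q; rewrite -(repK q) free_ext_cls.
elim: (rep q) => [x|o args IH] /=; first exact: hv.
rewrite cls_App; have /= -> := hH o (fun i => cls (args i)).
by congr interp; apply: funext.
Qed.

Lemma free_hom_eq (M : model Th) (h k : free_model -> M) :
  is_hom h -> is_hom k ->
  (forall x, h (free_var x) = k (free_var x)) -> h =1 k.
Proof.
move=> hH kH hk q.
by rewrite (free_ext_unique hH hk) -(free_ext_unique kH (fun=> erefl)).
Qed.

End FreeModel.

Arguments free_var Th {X} x.

Lemma hom_comp (Th : theory) (L M N : model Th) (g : M -> N) (f : L -> M) :
  is_hom g -> is_hom f -> is_hom (fun x => g (f x)).
Proof. by move=> gH fH o args; rewrite fH gH. Qed.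

Lemma hom_id (Th : theory) (M : model Th) : @is_hom Th M M id.
Proof. by []. Qed.

Definition free_map (Th : theory) (X Y : Type) (f : X -> Y) :
  free Th X -> free Th Y :=
  @free_ext Th X (free_model Th Y) (fun x => free_var Th (f x)).

Definition model_alg (Th : theory) (M : model Th) : free Th M -> M :=
  @free_ext Th M M id.

Definition free_mult (Th : theory) (X : Type) : free Th (free Th X) -> free Th X :=
  model_alg (M := free_model Th X).

Section FreeMonadLaws.
Variable Th : theory.

Lemma free_map_hom (X Y : Type) (f : X -> Y) :
  @is_hom Th (free_model Th X) (free_model Th Y) (@free_map Th X Y f).
Proof. exact: free_ext_hom. Qed.

Lemma model_alg_hom (M : model Th) :
  @is_hom Th (free_model Th M) M (@model_alg Th M).
Proof. exact: free_ext_hom. Qed.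

Lemma free_mult_hom (X : Type) :
  @is_hom Th (free_model Th (free Th X)) (free_model Th X) (@free_mult Th X).
Proof. exact: free_ext_hom. Qed.

Lemma free_unit_nat (X Y : Type) (f : X -> Y) (x : X) :
  free_map f (free_var Th x) = free_var Th (f x).
Proof. exact: (@free_ext_var Th X (free_model Th Y)). Qed.

Lemma model_alg_var (M : model Th) (x : M) : model_alg (free_var Th x) = x.
Proof. exact: free_ext_var. Qed.

Lemma free_mult_unitl (X : Type) (u : free Th X) :
  free_mult (free_var Th u) = u.
Proof. exact: (@model_alg_var (free_model Th X)). Qed.

Lemma free_map_id (X : Type) (u : free Th X) : free_map id u = u.
Proof.
apply: (@free_hom_eq Th X (free_model Th X) (free_map id) id) => //.
  exact: free_map_hom.
by move=> x; rewrite free_unit_nat.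
Qed.

Lemma free_map_comp (X Y Z : Type) (f : X -> Y) (g : Y -> Z) (u : free Th X) :
  free_map (g \o f) u = free_map g (free_map f u).
Proof.
apply: (@free_hom_eq Th X (free_model Th Z) _
          (fun u => free_map g (free_map f u))).
- exact: free_map_hom.
- exact: (hom_comp (@free_map_hom _ _ g) (@free_map_hom _ _ f)).
- by move=> x; rewrite !free_unit_nat.
Qed.

Lemma model_alg_nat (M N : model Th) (h : M -> N) (u : free Th M) :
  is_hom h -> h (model_alg u) = model_alg (free_map h u).
Proof.
move=> hH; apply: (@free_hom_eq Th M N (fun u => h (model_alg u))
                     (fun u => model_alg (free_map h u))).
- exact: (hom_comp hH (@model_alg_hom M)).
- exact: (hom_comp (@model_alg_hom N) (@free_map_hom _ _ h)).
- by move=> x; rewrite free_unit_nat !model_alg_var.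
Qed.

Lemma free_mult_nat (X Y : Type) (f : X -> Y) (u : free Th (free Th X)) :
  free_map f (free_mult u) = free_mult (free_map (free_map f) u).
Proof.
exact: (@model_alg_nat (free_model Th X) (free_model Th Y) _ u
          (@free_map_hom _ _ f)).
Qed.

Lemma free_mult_unitr (X : Type) (u : free Th X) :
  free_mult (free_map (@free_var Th X) u) = u.
Proof.
apply: (@free_hom_eq Th X (free_model Th X)
          (fun u => free_mult (free_map (@free_var Th X) u)) id) => //.
- exact: (hom_comp (@free_mult_hom X) (@free_map_hom _ _ _)).
- by move=> x; rewrite free_unit_nat free_mult_unitl.
Qed.

Lemma model_alg_mult (M : model Th) (u : free Th (free Th M)) :
  model_alg (free_mult u) = model_alg (free_map (@model_alg Th M) u).
Proof.
exact: (@model_alg_nat (free_model Th M) M _ u (@model_alg_hom M)).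
Qed.

Lemma free_mult_assoc (X : Type) (u : free Th (free Th (free Th X))) :
  free_mult (free_mult u) = free_mult (free_map (@free_mult Th X) u).
Proof. exact: (@model_alg_mult (free_model Th X)). Qed.

End FreeMonadLaws.

Definition free_model_monad (Th : theory) : monad :=
  @Monad (free Th) (@free_map Th) (@free_var Th) (@free_mult Th)
    (@free_map_id Th) (@free_map_comp Th) (@free_unit_nat Th)
    (@free_mult_nat Th) (@free_mult_unitl Th) (@free_mult_unitr Th)
    (@free_mult_assoc Th).

Lemma model_algP (Th : theory) (M : model Th) :
  is_algebra (T := free_model_monad Th) (@model_alg Th M).
Proof. by split; [exact: model_alg_var | exact: model_alg_mult]. Qed.

Definition alg_interp (Th : theory) (A : Type) (a : free_model_monad Th A -> A)
    (o : Th) (args : 'I_(arity o) -> A) : A :=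
  a (interp (free_model Th A) o (fun i => free_var Th (args i))).

Lemma alg_interp_model (Th : theory) (M : model Th) (o : Th)
    (args : 'I_(arity o) -> M) :
  alg_interp (@model_alg Th M) args = interp M o args.
Proof.
rewrite /alg_interp model_alg_hom; congr interp.
by apply: funext => i; rewrite model_alg_var.
Qed.

Section InducedByParallelLifting.
Variables (Th : theory) (zeta : forall X : Type,
  free_model_monad Th (delay_monad X) -> delay_monad (free_model_monad Th X)).

Definition induced_alg (M : model Th) (u : free_model_monad Th (delay_monad M)) :
    delay_monad M :=
  fmap delay_monad (@model_alg Th M) (zeta u).

(* The first conjunct says that induced_alg M is a T-algebra structure on the
   delay of M; naturality of zeta is not included. *)
Definition induced_by_parallel_lifting (o : Th) : Prop :=
  forall M : model Th,
    is_algebra (T := free_model_monad Th) (@induced_alg M) /\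
    (forall args : 'I_(arity o) -> delay_monad M,
       alg_interp (@induced_alg M) args = par (interp M o) args).

End InducedByParallelLifting.

(* Main.v *)
(* Naturality along the unit determines zeta on o(d_1, d_2) for arbitrary d_i,
   as the parallel lifting in the free model. Parallel lifting synchronises
   steps, so the number of steps is the maximum of those of the arguments. Take
   step (now (now x)) and now (step (now x)): after flattening, both take one
   step and zeta takes one step; applying zeta twice runs the outer step and
   then the inner one, so it takes two. *)
Require Import Defs.
From mathcomp Require Import all_boot.
From mathcomp Require Import boolp.

(** On a free model the induced algebra is [zeta] followed by [free_mult] under the delay.
    Naturality along [free_var] puts [free_map] of the unit in between, and the right unit law of
    the free monad cancels the two. *)
Lemma parallel_lifting_free (Th : theory) (o : Th)
  (zeta : forall X : Type,
     free_model_monad Th (delay_monad X) -> delay_monad (free_model_monad Th X))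
  (hnat : is_natural (free_model_monad Th) delay_monad zeta)
  (hpar : induced_by_parallel_lifting zeta o)
  (X : Type) (ds : 'I_(arity o) -> delay X) :
  zeta X (interp (free_model Th (delay X)) o (fun i => free_var Th (ds i))) =
  par (interp (free_model Th X) o) (fun i => delay_map (@free_var Th X) (ds i)).
Proof.
have [_ <-] := hpar (free_model Th X).
rewrite /alg_interp /induced_alg.
set u := interp _ _ _.
have <- : free_map (delay_map (@free_var Th X)) u =
    interp (free_model Th (delay (free Th X))) o
      (fun i => free_var Th (delay_map (@free_var Th X) (ds i))).
  rewrite /u free_map_hom; apply: (congr1 (@interp Th (free_model Th _) o)).
  by apply: funext => i; apply: free_unit_nat.
have /= -> := hnat _ _ (@free_var Th X) u.
rewrite -delay_map_comp -[LHS]delay_map_id; congr delay_map.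
by apply: funext => q; rewrite /= -[LHS](@free_mult_unitr Th X q).
Qed.

Lemma parallel_lifting_not_mult_law (Th : theory) (o : Th) (ho : arity o = 2)
  (zeta : forall X : Type,
     free_model_monad Th (delay_monad X) -> delay_monad (free_model_monad Th X))
  (hnat : is_natural (free_model_monad Th) delay_monad zeta)
  (hpar : induced_by_parallel_lifting zeta o) :
  ~ mult_law_D (free_model_monad Th) delay_monad zeta.
Proof.
have zetaE := parallel_lifting_free _ _ _ hnat hpar.
(* Testing the underlying number avoids a transport along [ho]. *)
pose first (i : 'I_(arity o)) := val i == 0.
have i0P : 0 < arity o by rewrite ho.
have i1P : 1 < arity o by rewrite ho.
pose dds i := if first i then step (now (now tt)) else now (step (now tt)).
move=> /(_ unit (interp (free_model Th _) o (fun i => free_var Th (dds i)))) /=.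
have -> : free_map (@delay_mult unit)
    (interp (free_model Th _) o (fun i => free_var Th (dds i))) =
  interp (free_model Th _) o (fun=> free_var Th (step (now tt))).
  rewrite free_map_hom; apply: (congr1 (@interp Th (free_model Th _) o)); apply: funext => i.
  by rewrite free_unit_nat /dds; case: ifP; rewrite !delayE.
rewrite !zetaE.
have -> : (fun=> delay_map (@free_var Th unit) (step (now tt))) =
    (fun _ : 'I_(arity o) => step (now (free_var Th tt))).
  by apply: funext => i; rewrite !delayE.
rewrite par_step; last by exists (Ordinal i0P); eexists.
under eq_fun do rewrite skip_step.
rewrite par_now [in RHS]par_step; last first.
  by exists (Ordinal i0P); rewrite /dds /= delayE; eexists.
(* Index 0 has spent the only outer step, so the outer lifting ends here; index 1 still holds its
   inner step. *)
have -> : (fun i => skip (delay_map (@free_var Th (delay unit)) (dds i))) =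
    (fun i => now (free_var Th (if first i then now tt else step (now tt)))).
  by apply: funext => i; rewrite /dds; case: ifP; rewrite !delayE ?skip_step.
(* The inner [zeta] takes the second step, forced by index 1. *)
rewrite par_now !delayE zetaE par_step; last first.
  by exists (Ordinal i1P); rewrite /= delayE; eexists.
(* Once a common step is removed, the left side has terminated and the right side has not. *)
by move=> /step_inj e; apply: (now_neq_step e).
Qed.

Theorem theorem5p5 (Th : theory) (o : Th) (ho : arity o = 2)
  (zeta : forall X : Type,
     free_model_monad Th (delay_monad X) -> delay_monad (free_model_monad Th X))
  (hnat : is_natural (free_model_monad Th) delay_monad zeta)
  (hpar : induced_by_parallel_lifting zeta o) :
  ~ is_distributive_law (free_model_monad Th) delay_monad zeta /\
  ~ mult_law_D (free_model_monad Th) delay_monad zeta.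
Proof.
have not_mult := parallel_lifting_not_mult_law _ _ ho _ hnat hpar.
by split=> // -[].
Qed.
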